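(* Let $F=(F_1,\dots,F_m):\mathbb{R}^n\to\mathbb{R}^m$ be twice continuously differentiable and let $\{x_k\}$ be an infinite sequence of points, none of which is Pareto critical, produced by the generic variable metric method (GVMM) from a starting point $x_0\in\mathbb{R}^n$, with associated matrices $\{B_k\}$. Suppose that (1) there exist constants $a,b>0$ such that $aI\leqslant B_k\leqslant bI$ for all $k$; (2) for any $x_0\in\mathbb{R}^n$, the level set $\{x\in\mathbb{R}^n: F(x)\leqslant F(x_0)\}$ is compact; (3) $\{x_k\}$ possesses an accumulation point $x^*$ with a corresponding multiplier $\lambda^*$ (i.e. $\lambda^*\in\Delta_m$ and $\sum_{i=1}^m\lambda_i^*\nabla F_i(x^* )=0$) such that $$d^{\mathrm T}\Big(\sum_{i=1}^m\lambda_i^*\nabla^2F_i(x^* )\Big)d>0\quad\text{for all } d\in\Omega,$$ where $\Omega=\{d\in\mathbb{R}^n\setminus\{0\}:\nabla F_i(x^* )^{\mathrm T}d=0,\ i=1,\dots,m\}$. Then the whole sequence converges: $\lim_{k\to\infty}x_k=x^*$.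
   Context: For vectors, $F(y)\leqslant F(z)$ is meant componentwise. For symmetric matrices, $A\leqslant B$ means $B-A$ is positive semidefinite. $JF(x)\in\mathbb{R}^{m\times n}$ is the Jacobian of $F$ at $x$, and $\nabla F_i(x)$, $\nabla^2F_i(x)$ are the gradient and Hessian of $F_i$. $\Delta_m=\{\lambda\in\mathbb{R}^m:\sum_{i=1}^m\lambda_i=1,\ \lambda_i\geqslant 0\ \text{for all } i\}$. A point $x^*\in\mathbb{R}^n$ is Pareto critical for $F$ if $\mathrm{range}(JF(x^* ))\cap(-\mathbb{R}^m_{++})=\emptyset$, i.e. there is no $d\in\mathbb{R}^n$ with $\nabla F_i(x^* )^{\mathrm T}d<0$ for all $i=1,\dots,m$. GVMM: fixed parameters $\sigma,\gamma\in(0,1)$. Given the current iterate $x_k$ and a symmetric positive definite matrix $B_k\in\mathbb{R}^{n\times n}$ (the rule by which the matrices $B_k$ are updated is arbitrary), choose $$\lambda^k\in\arg\min_{\lambda\in\Delta_m}\tfrac12\Big(\sum_{i=1}^m\lambda_i\nabla F_i(x_k)\Big)^{\mathrm T}B_k^{-1}\Big(\sum_{i=1}^m\lambda_i\nabla F_i(x_k)\Big),\qquad d_k=-B_k^{-1}\sum_{i=1}^m\lambda_i^k\nabla F_i(x_k).$$ Let $\alpha_k$ be the first element of $1,\gamma,\gamma^2,\dots$ such that $F(x_k+\alpha_kd_k)-F(x_k)\leqslant\sigma\alpha_kJF(x_k)d_k$ componentwise (Armijo line search), and set $x_{k+1}=x_k+\alpha_kd_k$. (The algorithm stops only if $\tfrac12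 d_k^{\mathrm T}B_kd_k$ is at most a given tolerance; it is assumed that it does not stop.) *)

(* Defs.v *)
From HB Require Import structures.
From mathcomp Require Import all_boot all_order all_algebra.
From mathcomp Require Import all_classical all_reals all_analysis.

Set Implicit Arguments.
Unset Strict Implicit.
Unset Printing Implicit Defensive.
Import Order.TTheory GRing.Theory Num.Theory.
Import numFieldNormedType.Exports.

Local Open Scope classical_set_scope.
Local Open Scope ring_scope.

(* Vectors of R^n are row vectors 'rV[R]_n, as in the
   library Jacobian: 'J F x is the transpose of the usual m x n Jacobian
   matrix, so that d *m 'J F x is the row vector JF(x)d. *)

Section LinearAlgebra.
Context {R : realType}.

Definition dot n (u v : 'rV[R]_n) : R := (u *m v^T) ord0 ord0.

Definition quad n (A : 'M[R]_n) (v : 'rV[R]_n) : R :=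
  (v *m A *m v^T) ord0 ord0.

Definition psd n (A : 'M[R]_n) : Prop :=
  A^T = A /\ forall v, 0 <= quad A v.

Definition posdef n (A : 'M[R]_n) : Prop :=
  A^T = A /\ forall v, v != 0 -> 0 < quad A v.

Definition loewner_le n (A B : 'M[R]_n) : Prop := psd (B - A).

Definition vec_le m (y z : 'rV[R]_m) : Prop :=
  forall i, y ord0 i <= z ord0 i.

Definition simplex m : set 'rV[R]_m :=
  [set l | \sum_(i < m) l ord0 i = 1 /\ forall i, 0 <= l ord0 i].

Definition argmin T (D : set T) (f : T -> R) : set T :=
  [set t | D t /\ forall s, D s -> f t <= f s].

End LinearAlgebra.

Section Calculus.
Context {R : realType}.

Definition component n m (F : 'rV[R]_n -> 'rV[R]_m) (i : 'I_m) :
  'rV[R]_n -> R := fun x => F x ord0 i.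

Definition gradient n (f : 'rV[R]_n -> R) : 'rV[R]_n -> 'rV[R]_n :=
  fun x => \row_(j < n) 'D_(delta_mx ord0 j) f x.

Definition hessian n (f : 'rV[R]_n -> R) : 'rV[R]_n -> 'M[R]_n :=
  fun x => 'J (gradient f) x.

Definition continuously_differentiable n m (F : 'rV[R]_n -> 'rV[R]_m) : Prop :=
  (forall x, differentiable F x) /\ continuous (fun x => 'J F x).

(* By the second clause every Hessian is continuous. *)
Definition twice_continuously_differentiable n m
    (F : 'rV[R]_n -> 'rV[R]_m) : Prop :=
  continuously_differentiable F /\
  forall i, continuously_differentiable (gradient (component F i)).

End Calculus.

Section Multiobjective.
Context {R : realType}.
Variables (n m : nat) (F : 'rV[R]_n -> 'rV[R]_m).

Definition weighted_gradient (l : 'rV[R]_m) (x : 'rV[R]_n) : 'rV[R]_n :=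
  \sum_(i < m) l ord0 i *: gradient (component F i) x.

Definition weighted_hessian (l : 'rV[R]_m) (x : 'rV[R]_n) : 'M[R]_n :=
  \sum_(i < m) l ord0 i *: hessian (component F i) x.

Definition pareto_critical (x : 'rV[R]_n) : Prop :=
  range (fun d : 'rV[R]_n => d *m 'J F x)
    `&` [set y : 'rV[R]_m | forall i, y ord0 i < 0] = set0.

Definition level_set (x0 : 'rV[R]_n) : set 'rV[R]_n :=
  [set x | vec_le (F x) (F x0)].

Definition multiplier (x : 'rV[R]_n) (l : 'rV[R]_m) : Prop :=
  simplex l /\ weighted_gradient l x = 0.

Definition critical_directions (x : 'rV[R]_n) : set 'rV[R]_n :=
  [set d | d != 0 /\ forall i, dot (gradient (component F i) x) d = 0].

Definition armijo (sigma : R) (x d : 'rV[R]_n) (alpha : R) : Prop :=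
  vec_le (F (x + alpha *: d) - F x) ((sigma * alpha) *: (d *m 'J F x)).

Definition armijo_step (sigma gamma : R) (x d : 'rV[R]_n) (alpha : R) : Prop :=
  exists j : nat,
    [/\ alpha = gamma ^+ j,
        armijo sigma x d (gamma ^+ j) &
        forall i : nat, (i < j)%N -> ~ armijo sigma x d (gamma ^+ i)].

(* One iteration from x to x' with the matrix B; the column vector
   - B^-1 g is the transpose of the row vector - g *m (B^-1)^T. *)
Definition gvmm_step (sigma gamma : R) (B : 'M[R]_n) (x x' : 'rV[R]_n) : Prop :=
  exists (l : 'rV[R]_m) (d : 'rV[R]_n) (alpha : R),
    [/\ argmin (@simplex R m)
          (fun l => 2^-1 * quad (invmx B) (weighted_gradient l x)) l,
        d = - (weighted_gradient l x *m (invmx B)^T),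
        armijo_step sigma gamma x d alpha &
        x' = x + alpha *: d].

Definition gvmm_sequence (sigma gamma : R) (B : nat -> 'M[R]_n)
    (x : nat -> 'rV[R]_n) : Prop :=
  forall k, posdef (B k) /\ gvmm_step sigma gamma (B k) (x k) (x k.+1).

End Multiobjective.

(* Main.v *)
Require Import Defs.
From HB Require Import structures.
From mathcomp Require Import all_boot all_order all_algebra.
From mathcomp Require Import all_classical all_reals all_analysis.
From mathcomp Require Import ring lra.

Set Implicit Arguments.
Unset Strict Implicit.
Unset Printing Implicit Defensive.
Import Order.TTheory GRing.Theory Num.Theory.
Import numFieldNormedType.Exports.

Local Open Scope classical_set_scope.
Local Open Scope ring_scope.

(* Write p for the accumulation point.  Armijo's rule and B_k >= a I give
   sigma a |x_{k+1} - x_k|^2 <= F_i(x_k) - F_i(x_{k+1}) for every i.  Hence F(x_k)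
   decreases to F(p), the steps tend to 0, and F(q) = F(p) at every cluster point q.
   The second-order condition isolates p in its level {F = F(p)}: as y tends to p
   along this level, a limit d of (y - p)/|y - p| satisfies grad F_i(p).d = 0 for all
   i, and Rolle's theorem for sum_i l_i F_i on the segment [p, y] gives d^T H d = 0.
   An isolated cluster point of a sequence whose steps tend to 0 is its limit. *)

(** * Cluster points of filters *)

Section Filters.

(** If the complement of [A] is not in [G], the trace of [G] on [A] is a proper filter. Compactness
    gives it a cluster point, which [G] inherits because the trace is finer. *)
Lemma compact_cluster_frequently (T : topologicalType) (A : set T)
    (G : set_system T) {FG : Filter G} :
  compact A -> ~ G (~` A) -> exists2 q, A q & cluster G q.
Proof.
move=> Aco nGA.
have FwA : ProperFilter (within A G).
  split; last exact: within_filter.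
  by rewrite /within /= => G0; apply: nGA; apply: filterS G0 => y + Ay; exact.
have [q [Aq clq]] := Aco _ FwA (withinT _ FG).
by exists q => //; apply: cvg_cluster clq; exact: cvg_within.
Qed.

(** Some proper filter finer than [G] converges to [p]; along it [f] tends both to [f p] and to
    [l]. *)
Lemma cluster_lim (T U : topologicalType) (G : set_system T) {FG : Filter G}
    (p : T) (f : T -> U) (l : U) :
  hausdorff_space U -> cluster G p -> {for p, continuous f} ->
  f @ G --> l -> f p = l.
Proof.
move=> hU; rewrite cluster_cvgE => -[G' PG' [G'p GG']] fp fl.
apply: (cvg_unique hU (F := f @ G')); first exact: cvg_trans (cvg_app f G'p) fp.
exact: (cvg_trans (cvg_app f GG') fl).
Qed.

End Filters.

Lemma continuous_sum (R : realType) (T : topologicalType) (I : finType)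
    (f : I -> T -> R) :
  (forall i, continuous (f i)) -> continuous (fun x => \sum_i f i x).
Proof.
move=> fc; apply: (@continuous_big R I +%R 0 predT _ T (index_enum I) f).
  by move=> z; apply: cvgD; [exact: cvg_fst|exact: cvg_snd].
by move=> i _; exact: fc.
Qed.

(** * Scalar products and quadratic forms *)

Section Dot.
Variables (R : realType) (n : nat).
Implicit Types u v w : 'rV[R]_n.

Lemma dotE u v : dot u v = \sum_j u ord0 j * v ord0 j.
Proof. by rewrite /dot mxE; apply: eq_bigr => j _; rewrite mxE. Qed.

Lemma dotC u v : dot u v = dot v u.
Proof. by rewrite !dotE; apply: eq_bigr => j _; rewrite mulrC. Qed.

Lemma dotDl u v w : dot (u + v) w = dot u w + dot v w.
Proof. by rewrite /dot mulmxDl mxE. Qed.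

Lemma dotDr u v w : dot u (v + w) = dot u v + dot u w.
Proof. by rewrite dotC dotDl ![dot _ u]dotC. Qed.

Lemma dotZl (c : R) u w : dot (c *: u) w = c * dot u w.
Proof. by rewrite /dot -scalemxAl mxE. Qed.

Lemma dotZr (c : R) u w : dot u (c *: w) = c * dot u w.
Proof. by rewrite dotC dotZl dotC. Qed.

Lemma dotNr u w : dot u (- w) = - dot u w.
Proof. by rewrite -scaleN1r dotZr mulN1r. Qed.

Lemma dotNl u w : dot (- u) w = - dot u w.
Proof. by rewrite dotC dotNr dotC. Qed.

Lemma quadE (A : 'M[R]_n) v : quad A v = dot (v *m A) v.
Proof. by []. Qed.

Lemma quadZ (A : 'M[R]_n) (c : R) v : quad A (c *: v) = c ^+ 2 * quad A v.
Proof. by rewrite !quadE -scalemxAl dotZl dotZr mulrA expr2. Qed.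

Lemma coord_le_norm u j : `|u ord0 j| <= `|u|.
Proof.
rewrite [leRHS]/Num.norm /= mx_normrE; apply/bigmax_geP; right => /=.
by exists (ord0, j).
Qed.

(** The norm on row vectors is the maximum norm, hence the factor [n] in this form of
    Cauchy-Schwarz. *)
Lemma ler_norm_dot u v : `|dot u v| <= n%:R * (`|u| * `|v|).
Proof.
rewrite dotE (le_trans (ler_norm_sum _ _ _))//.
have -> : n%:R * (`|u| * `|v|) = \sum_(j < n) `|u| * `|v|.
  by rewrite sumr_const card_ord mulr_natl.
by apply: ler_sum => j _; rewrite normrM ler_pM// coord_le_norm.
Qed.

(** The maximum norm is attained at some coordinate, whose square is one summand of [dot u u]. *)
Lemma norm_sqr_le_dot u : `|u| ^+ 2 <= dot u u.
Proof.
have [/eqP|u0] := eqVneq `|u| 0.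
  rewrite normr_eq0 => /eqP ->; rewrite normr0 expr0n/= dotE sumr_ge0// => j _.
  by rewrite -expr2 sqr_ge0.
have [[i j] uij] := mx_norm_neq0 u0.
rewrite [`|u|]uij/= real_normK ?num_real// dotE (ord1 i) (bigD1 j)//= -expr2 lerDl.
by rewrite sumr_ge0// => k _; rewrite -expr2 sqr_ge0.
Qed.

Lemma continuous_dotr w : continuous (fun v => dot w v).
Proof.
have -> : (fun v => dot w v) = (fun v => \sum_j w ord0 j * v ord0 j).
  by apply/funext => v; rewrite dotE.
apply: continuous_sum => j v.
by apply: continuousM; [exact: cst_continuous|exact: coord_continuous].
Qed.

Lemma continuous_quad (A : 'M[R]_n) : continuous (quad A).
Proof.
have -> : quad A = (fun v => \sum_j \sum_k v ord0 k * A k j * v ord0 j).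
  apply/funext => v; rewrite quadE dotE; apply: eq_bigr => j _.
  by rewrite mxE mulr_suml.
apply: continuous_sum => j.
apply: continuous_sum => k v.
apply: (@continuousM _ _ (fun x : 'rV[R]_n => x ord0 k * A k j)
  (fun x : 'rV[R]_n => x ord0 j) v); last exact: coord_continuous.
by apply: continuousM; [exact: coord_continuous|exact: cst_continuous].
Qed.

End Dot.

(** * First- and second-order expansions along a level set *)

Section Calculus.
Variables (R : realType) (n : nat).

Lemma dot_gradient (f : 'rV[R]_n -> R) y v :
  differentiable f y -> dot (gradient f y) v = 'd f y v.
Proof.
move=> dfy; rewrite dotE [v in RHS]row_sum_delta linear_sum; apply: eq_bigr => j _.
by rewrite linearZ/= mxE deriveE// mulrC.
Qed.

Lemma is_derive_line (f : 'rV[R]_n -> R) (p h : 'rV[R]_n) (t : R) :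
  differentiable f (p + t *: h) ->
  is_derive t 1 (fun s => f (p + s *: h)) (dot (gradient f (p + t *: h)) h).
Proof.
move=> df.
(* The difference quotient of the restriction to the line at [t] is that of [f] at [p + t *: h] in
   direction [h]. *)
have E : (fun e : R => e^-1 *:
      ((fun s => f (p + s *: h)) (e *: 1 + t) - f (p + t *: h)))
  = (fun e : R => e^-1 *: (f (e *: h + (p + t *: h)) - f (p + t *: h))).
  by apply/funext => e; rewrite -[e *: 1]/(e * 1) mulr1 scalerDl addrCA.
split.
  have := @diff_derivable _ _ _ f _ h df.
  by rewrite /derivable /= E.
by rewrite dot_gradient// -deriveE// /derive /= E.
Qed.

Lemma mean_value_level (f : 'rV[R]_n -> R) (p h : 'rV[R]_n) :
  (forall y, differentiable f y) -> f (p + h) = f p ->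
  exists2 t : R, 0 < t < 1 & dot (gradient f (p + t *: h)) h = 0.
Proof.
move=> df fph; pose phi (s : R) := f (p + s *: h).
have dphi (t : R) : is_derive t 1 phi (dot (gradient f (p + t *: h)) h).
  exact: is_derive_line.
have [t _|||t t01 phit] := @Rolle _ phi 0 1 ltr01.
- by have [] := dphi t.
- apply: continuous_subspaceT => t; apply: differentiable_continuous.
  by apply/derivable1_diffP; have [] := dphi t.
- by rewrite /phi scale0r scale1r addr0 fph.
exists t; first by rewrite in_itv in t01.
have [_ <-] := dphi t.
by have [_ ->] := phit.
Qed.

Lemma near_diff (V W : normedModType R) (f : V -> W) (p : V) (e : R) :
  differentiable f p -> 0 < e ->
  \forall y \near p, `|f y - f p - 'd f p (y - p)| <= e * `|y - p|.
Proof.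
move=> [[_ fE]] e0; have := (eqaddoP _ _ _ _).1 fE _ e0.
by apply: filterS => y; rewrite /= lim_id// !fctE/= opprD addrA.
Qed.

Lemma near_level_gradient (f : 'rV[R]_n -> R) (p : 'rV[R]_n) (e : R) :
  differentiable f p -> 0 < e ->
  \forall y \near p, f y = f p -> `|dot (gradient f p) (y - p)| <= e * `|y - p|.
Proof.
move=> dfp e0; have := near_diff dfp e0; apply: filterS => y + fy.
by rewrite fy subrr sub0r normrN dot_gradient.
Qed.

(** With [h = y - p], Rolle gives a point [p + t *: h] where the gradient is orthogonal to [h].
    Since the gradient vanishes at [p], it equals the Hessian applied to [t *: h] up to an error
    small against [t |h|]. Pairing with [h] and cancelling [t > 0] gives the bound. *)
Lemma near_level_hessian (f : 'rV[R]_n -> R) (p : 'rV[R]_n) (e : R) :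
  (forall y, differentiable f y) -> differentiable (gradient f) p ->
  gradient f p = 0 -> 0 < e ->
  \forall y \near p, f y = f p ->
    `|quad (hessian f p) (y - p)| <= e * `|y - p| ^+ 2.
Proof.
move=> df dg g0 e0.
(* Dividing [e] by [n.+1] absorbs the factor [n] of [ler_norm_dot] and is still legitimate for
   [n = 0]. *)
have n0 : 0 < n.+1%:R :> R by rewrite ltr0n.
have /nbhs_ballP[r /= r0 br] := near_diff dg (divr_gt0 e0 n0).
near=> y => fy; set h := y - p.
have [|t /andP[t0 t1] tE] := @mean_value_level f p h df.
  by rewrite /h addrC subrK.
have : ball p r (p + t *: h).
  rewrite -ball_normE /ball_ /= opprD addNKr normrN normrZ gtr0_norm//.
  apply: (@le_lt_trans _ _ `|h|); first by rewrite ler_piMl// ltW.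
  rewrite /h distrC; near: y.
  by have := nbhsx_ballx p r r0; rewrite -ball_normE.
move=> /br; rewrite [p + t *: h - p]addrAC subrr add0r g0 subr0 linearZ/=.
rewrite normrZ gtr0_norm// => H.
have qE : t * quad (hessian f p) h =
    - dot (gradient f (p + t *: h) - t *: 'd (gradient f) p h) h.
  rewrite dotDl tE add0r dotNl opprK dotZl quadE /hessian.
  by rewrite -deriveEjacobian// deriveE.
rewrite -(ler_pM2l t0) -{1}(gtr0_norm t0) -normrM qE normrN.
rewrite (le_trans (ler_norm_dot _ _))//.
have -> : t * (e * `|h| ^+ 2) = n.+1%:R * (e / n.+1%:R * (t * `|h|) * `|h|).
  by field; rewrite gt_eqF.
by rewrite ler_pM// ?ler_nat// ?ler_wpM2r.
Unshelve. all: by end_near. Qed.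

End Calculus.

(** * Sequences with vanishing steps and an isolated cluster point *)

Section IsolatedCluster.
Variables (R : realType) (n : nat).

Lemma compact_annulus (p : 'rV[R]_n) (a b : R) :
  compact [set q : 'rV[R]_n | a <= `|q - p| <= b].
Proof.
apply: bounded_closed_compact.
  exists (b + `|p|); split; first exact: num_real.
  move=> M bM q /= /andP[_ qb]; apply: le_trans (ltW bM).
  by rewrite -{1}(subrK p q) (le_trans (ler_normD _ _))// lerD2r.
have -> : [set q : 'rV[R]_n | a <= `|q - p| <= b] =
    (fun q : 'rV[R]_n => `|q - p|) @^-1` `[a, b]%classic.
  by apply/seteqP; split => q /=; rewrite in_itv.
apply: preimage_closed; last exact: interval_closed.
move=> q _; apply: (@continuous_comp _ _ _ (fun q : 'rV[R]_n => q - p)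
  (fun q : 'rV[R]_n => `|q|)).
  by apply: continuousB => //; exact: cst_continuous.
exact: norm_continuous.
Qed.

(** A small closed annulus around [p] contains no cluster point, so by compactness the sequence
    eventually avoids it. Steps shorter than the width of the annulus cannot jump across, so the
    sequence stays inside once it has entered the inner ball. *)
Lemma cvg_isolated_cluster (u : nat -> 'rV[R]_n) (p : 'rV[R]_n) :
  cluster (u @ \oo) p -> (fun k => `|u k.+1 - u k|) @ \oo --> (0 : R) ->
  (\forall q \near p, cluster (u @ \oo) q -> q = p) -> u @ \oo --> p.
Proof.
move=> clp u0 /nbhs_ballP[r /= r0 br]; apply/cvgrPdist_lt => e e0.
(* Halving makes the outer radius strictly smaller than both [e] and the isolation radius [r]. *)
pose s := Num.min e r / 2.
have s0 : 0 < s by rewrite divr_gt0// lt_min e0.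
have [se sr] : s < e /\ s < r.
  split; rewrite /s ltr_pdivrMr// gt_min mulr_natr mulr2n !ltrDl;
    by rewrite ?e0 ?r0 ?orbT.
pose A := [set q : 'rV[R]_n | s / 2 <= `|q - p| <= s].
have uA : \forall k \near \oo, ~ A (u k).
  apply: contrapT => nuA.
  have [q Aq clq] := compact_cluster_frequently (G := u @ \oo)
    (@compact_annulus p (s / 2) s) nuA.
  have qp : q = p.
    apply: br clq; rewrite -ball_normE /ball_/= distrC.
    by case/andP: Aq => _ /le_lt_trans; apply.
  by case/andP: Aq; rewrite qp subrr normr0 leNgt divr_gt0.
have us : \forall k \near \oo, `|u k.+1 - u k| < s / 2.
  move/cvgr0Pnorm_lt : u0 => /(_ _ (divr_gt0 s0 (ltr0Sn _ 1))).
  by apply: filterS => k; rewrite normr_id.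
have [N _ NP] := filterI uA us.
(* As [p] is a cluster point, some index [k] beyond [N] has [u k] in the inner ball; the induction
   starts there. *)
have [_ [[k /= Nk <-] pk]] :
    [set u k | k in [set k | (N <= k)%N]] `&` ball p (s / 2) !=set0.
  apply: clp; last exact: nbhsx_ballx (divr_gt0 s0 (ltr0Sn _ 1)).
  by exists N => // k Nk; exists k.
exists k => // j /= kj; rewrite distrC (le_lt_trans _ se)// ltW//.
apply: (@lt_trans _ _ (s / 2)); last by rewrite ltr_pdivrMr// mulr_natr mulr2n ltrDl.
elim: j kj => [|j IH].
  by rewrite leqn0 => /eqP k0; move: pk; rewrite k0 -ball_normE /ball_/= distrC.
rewrite leq_eqVlt ltnS => /predU1P[<-|kj].
  by move: pk; rewrite -ball_normE /ball_/= distrC.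
have [_ st] := NP j (leq_trans Nk kj).
have [nA _] := NP j.+1 (leq_trans Nk (leqW kj)).
(* Were [u j.+1] outside the inner ball, the triangle inequality would bound its distance to [p] by
   [s / 2 + s / 2], placing it in the annulus. *)
rewrite ltNge; apply/negP => sj; apply: nA; rewrite /A/= sj/=.
have -> : u j.+1 - p = (u j.+1 - u j) + (u j - p) by rewrite addrA subrK.
rewrite (le_trans (ler_normD _ _))// [leRHS](splitr s) lerD// ltW//.
exact: IH.
Qed.

End IsolatedCluster.

(** * Isolation of a point in its level under the second-order condition *)

Section Level.
Variables (R : realType) (n m : nat) (F : 'rV[R]_n -> 'rV[R]_m).

Lemma differentiable_component (i : 'I_m) y :
  differentiable F y -> differentiable (component F i) y.
Proof.
move=> dF; apply: (@differentiable_comp _ _ _ _ F (fun z => z ord0 i)) => //.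
exact: differentiable_coord.
Qed.

Lemma dot_gradient_component (i : 'I_m) y d :
  differentiable F y ->
  dot (gradient (component F i) y) d = (d *m 'J F y) ord0 i.
Proof.
move=> dF; rewrite dot_gradient; last exact: differentiable_component.
rewrite -deriveEjacobian// derive_mx; last exact: diff_derivable.
by rewrite mxE deriveE//; exact: differentiable_component.
Qed.

(** With the weights fixed, its gradient is the weighted gradient, so a multiplier at [p] makes [p]
    a stationary point of one scalar function. *)
Definition scalarization (l : 'rV[R]_m) : 'rV[R]_n -> R :=
  fun y => \sum_i l ord0 i * component F i y.

Lemma scalarizationE l :
  scalarization l = \sum_i l ord0 i \*: component F i.
Proof. by apply/funext => y; rewrite fct_sumE. Qed.

Lemma differentiable_scalarization l y :
  differentiable F y -> differentiable (scalarization l) y.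
Proof.
move=> dF; rewrite scalarizationE; apply: differentiable_sum => i.
by apply: differentiableZ; exact: differentiable_component.
Qed.

Lemma gradient_scalarization l :
  (forall y, differentiable F y) ->
  gradient (scalarization l) = weighted_gradient F l.
Proof.
move=> dF; apply/funext => y; apply/rowP => j.
have dc i : derivable (component F i) y (delta_mx ord0 j).
  by apply: diff_derivable; exact: differentiable_component.
rewrite mxE summxE scalarizationE derive_sum => [|i]; last exact: derivableZ.
by apply: eq_bigr => i _; rewrite deriveZ// !mxE.
Qed.

Lemma weighted_gradientE l :
  weighted_gradient F l = \sum_i l ord0 i \*: gradient (component F i).
Proof. by apply/funext => y; rewrite fct_sumE. Qed.

Lemma differentiable_weighted_gradient l y :
  (forall i, differentiable (gradient (component F i)) y) ->
  differentiable (weighted_gradient F l) y.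
Proof.
move=> dG; rewrite weighted_gradientE; apply: differentiable_sum => i.
exact: differentiableZ.
Qed.

(** Both sides are the derivative of the weighted gradient in direction [d]. *)
Lemma jacobian_weighted_gradient l y (d : 'rV[R]_n) :
  (forall i, differentiable (gradient (component F i)) y) ->
  d *m 'J (weighted_gradient F l) y = d *m weighted_hessian F l y.
Proof.
move=> dG; rewrite -deriveEjacobian; last exact: differentiable_weighted_gradient.
have dc i : derivable (gradient (component F i)) y d by exact: diff_derivable.
rewrite weighted_gradientE derive_sum => [|i]; last exact: derivableZ.
rewrite mulmx_sumr; apply: eq_bigr => i _.
by rewrite deriveZ// deriveEjacobian// -scalemxAr.
Qed.

Lemma isolated_level (p : 'rV[R]_n) (l : 'rV[R]_m) :
  (forall y, differentiable F y) ->
  (forall i, differentiable (gradient (component F i)) p) ->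
  weighted_gradient F l p = 0 ->
  (forall d, critical_directions F p d -> 0 < quad (weighted_hessian F l p) d) ->
  \forall y \near p, F y = F p -> y = p.
Proof.
move=> dF dG wg0 sosc; apply: contrapT => nH.
pose D := [set y | y != p /\ F y = F p].
have nD : ~ nbhs p (~` D).
  apply: contra_not nH; apply: filterS => y nDy Fy.
  by apply: contrapT => /eqP yp; apply: nDy.
(* [G] describes approach to [p] through the other points of its level; it is proper because [p] is
   assumed not isolated there. *)
pose G := within D (nbhs p).
have PG : ProperFilter G.
  split; last exact: within_filter.
  by rewrite /G /within /= => G0; apply: nD; apply: filterS G0 => y + Dy; exact.
pose u y := `|y - p|^-1 *: (y - p).
(* The unit sphere, written as a degenerate annulus so that [compact_annulus] yields a cluster
   direction [d]. *)
have GS : (u @ G) [set q | 1 <= `|q - 0| <= 1].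
  apply: filterS (withinT D (nbhs_filter p)) => y [yp _] /=.
  rewrite subr0 /u normrZ normfV normr_id mulVf ?lexx//.
  by rewrite normr_eq0 subr_eq0.
have [d [/andP[d1 _] cld]] := compact_annulus (fmap_proper_filter u PG) GS.
(* A continuous function that tends to 0 along the normalized differences vanishes at [d]. It serves
   for each gradient pairing and for the Hessian form. *)
have zero (f : 'rV[R]_n -> R) : continuous f ->
    (forall e, 0 < e -> \forall y \near p, y != p -> F y = F p -> `|f (u y)| <= e) ->
    f d = 0.
  move=> fc fe; apply: (cluster_lim (@Rhausdorff R) cld (fc d)).
  apply/cvgr0Pnorm_le => e e0.
  have := fe _ e0; rewrite /= /G !near_simpl /within /=.
  by apply: filterS => y H [yp Fy]; exact: H.
have d0 : d != 0 by rewrite -normr_gt0 -[d]subr0 (lt_le_trans ltr01).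
suff : quad (weighted_hessian F l p) d = 0.
  move=> q0; have := sosc d; rewrite q0 ltxx => H; suff: false by []; apply: H.
  split=> // i; apply: zero; first exact: continuous_dotr.
  move=> e e0; have := near_level_gradient (differentiable_component i (dF p)) e0.
  apply: filterS => y H yp Fy.
  have yp0 : 0 < `|y - p| by rewrite normr_gt0 subr_eq0.
  rewrite /u dotZr normrM normfV normr_id ler_pdivrMl// mulrC H//.
  by rewrite /component Fy.
apply: zero; first exact: continuous_quad.
move=> e e0; have gE := gradient_scalarization l dF.
have := @near_level_hessian _ _ (scalarization l) p e.
rewrite gE => /(_ (fun y => differentiable_scalarization l (dF y))
  (differentiable_weighted_gradient l dG) wg0 e0).
apply: filterS => y H yp Fy.
have yp0 : 0 < `|y - p| by rewrite normr_gt0 subr_eq0.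
rewrite /u quadZ normrM exprVn normfV normrX normr_id ler_pdivrMl ?exprn_gt0// mulrC.
rewrite quadE -jacobian_weighted_gradient//.
have -> : dot ((y - p) *m 'J (weighted_gradient F l) p) (y - p) =
   quad (hessian (scalarization l) p) (y - p) by rewrite quadE /hessian gE.
by apply: H; apply: eq_bigr => i _; rewrite /component Fy.
Qed.

End Level.

(** * Symmetric and positive definite matrices *)

Section Descent.
Variables (R : realType) (n : nat).

Lemma posdef_unitmx (B : 'M[R]_n) : posdef B -> B \in unitmx.
Proof.
move=> [_ Bpos]; rewrite -row_free_unit -kermx_eq0.
apply/rowV0P => v /sub_kermxP vB; apply/eqP; apply: contraT => /Bpos.
by rewrite quadE vB /dot mul0mx mxE ltxx.
Qed.

Lemma dot_mulmx_sym (P : 'M[R]_n) u v :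
  P^T = P -> dot (u *m P) v = dot (v *m P) u.
Proof.
move=> Psym; rewrite [RHS]dotC /dot trmx_mul Psym.
by rewrite mulmxA.
Qed.

Lemma quadDZ (P : 'M[R]_n) u v (t : R) : P^T = P ->
  quad P (u + t *: v) =
  quad P u + t * (2 * dot (u *m P) v + t * quad P v).
Proof.
move=> Psym; rewrite !quadE mulmxDl -scalemxAl dotDl !dotDr !dotZl !dotZr.
by rewrite (dot_mulmx_sym v u Psym); ring.
Qed.

Lemma loewner_le_scalar (B : 'M[R]_n) (a : R) (v : 'rV[R]_n) :
  loewner_le a%:M B -> a * dot v v <= quad B v.
Proof.
move=> [_ /(_ v)]; rewrite quadE mulmxBr dotDl dotNl mul_mx_scalar dotZl.
by rewrite subr_ge0.
Qed.

End Descent.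

(** * Sufficient decrease in one iteration *)

Section Step.
Variables (R : realType) (n m : nat) (F : 'rV[R]_n -> 'rV[R]_m).

(** The weighted gradient is linear in the weights, and its value at the vertex [delta_mx ord0 i] is
    the gradient of the [i]-th component. *)
Lemma weighted_gradient_segment (l : 'rV[R]_m) (i : 'I_m) (t : R) y :
  weighted_gradient F (l + t *: (delta_mx ord0 i - l)) y =
  weighted_gradient F l y +
    t *: (gradient (component F i) y - weighted_gradient F l y).
Proof.
have -> : gradient (component F i) y = weighted_gradient F (delta_mx ord0 i) y.
  rewrite /weighted_gradient (bigD1 i)//= mxE !eqxx scale1r big1 ?addr0// => j ji.
  by rewrite mxE (negbTE ji) andbF scale0r.
rewrite /weighted_gradient -sumrB scaler_sumr -big_split/=.
by apply: eq_bigr => j _; rewrite !mxE -scalerBl scalerA -scalerDl.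
Qed.

Lemma simplex_segment (l : 'rV[R]_m) (i : 'I_m) (t : R) :
  simplex l -> 0 <= t <= 1 -> simplex (l + t *: (delta_mx ord0 i - l)).
Proof.
move=> [l1 l0] /andP[t0 t1]; split.
  under eq_bigr do rewrite !mxE eqxx/=.
  rewrite big_split/= -mulr_sumr sumrB l1 (bigD1 i)//= eqxx big1 => [|j ji].
    by rewrite addr0 subrr mulr0 addr0.
  by rewrite (negbTE ji).
move=> j; rewrite !mxE eqxx/=.
have -> : l ord0 j + t * ((j == i)%:R - l ord0 j) =
    (1 - t) * l ord0 j + t * (j == i)%:R by ring.
by rewrite addr_ge0// mulr_ge0// ?subr_ge0.
Qed.

(* First-order optimality of [l], tested against the vertices of the simplex. *)
Lemma argmin_simplex_le (P : 'M[R]_n) (l : 'rV[R]_m) y (i : 'I_m) :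
  P^T = P ->
  argmin (@simplex R m) (fun l => 2^-1 * quad P (weighted_gradient F l y)) l ->
  quad P (weighted_gradient F l y) <=
  dot (weighted_gradient F l y *m P) (gradient (component F i) y).
Proof.
move=> Psym [lS lmin]; set g := weighted_gradient F l y.
set w := gradient (component F i) y - g.
rewrite -subr_ge0 quadE.
have -> : dot (g *m P) (gradient (component F i) y) - dot (g *m P) g =
    dot (g *m P) w.
  by rewrite dotDr dotNr.
set b := dot _ _; set q := quad P w.
(* Moving from [l] by [t] towards vertex [i] changes the quadratic form by [t * (2 * b + t * q)];
   minimality makes this nonnegative, and [t > 0] is divided out. *)
have bq t : 0 < t <= 1 -> 0 <= 2 * b + t * q.
  move=> /andP[t0 t1].
  have := lmin _ (simplex_segment i lS _); rewrite -/g => /(_ t).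
  rewrite (ltW t0) t1 => /(_ isT).
  by rewrite ler_pM2l ?invr_gt0// weighted_gradient_segment quadDZ// lerDl pmulr_rge0.
rewrite leNgt; apply/negP => b0.
have c0 : 0 < `|q| - b by rewrite subr_gt0 (lt_le_trans b0).
(* If [b < 0], this admissible [t] satisfies [t * q <= - b], whence [2 * b + t * q <= b < 0], a
   contradiction. *)
have t0 : 0 < - b / (`|q| - b) <= 1.
  by rewrite divr_gt0 ?oppr_gt0//= ler_pdivrMr// mul1r lerDr.
have := bq _ t0; apply/negP; rewrite -ltNge.
have /andP[t00 t1] := t0.
have : - b / (`|q| - b) * q <= - b.
  rewrite (le_trans (ler_wpM2l (ltW t00) (ler_norm q)))//.
  rewrite mulrAC ler_pdivrMr//.
  by rewrite ler_pM2l ?oppr_gt0// lerDl oppr_ge0 ltW.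
lra.
Qed.

(** Optimality of the weights bounds every directional derivative along [d] by [- quad B d], which
    is at most [- a |d|^2]. The Armijo inequality turns this slope into decrease of each
    component. *)
Lemma gvmm_step_descent (sigma gamma a : R) (B : 'M[R]_n) (x x' : 'rV[R]_n)
    (i : 'I_m) :
  0 < sigma -> 0 < gamma < 1 -> 0 < a -> differentiable F x ->
  posdef B -> loewner_le a%:M B -> gvmm_step F sigma gamma B x x' ->
  sigma * a * `|x' - x| ^+ 2 <= F x ord0 i - F x' ord0 i.
Proof.
move=> sigma0 /andP[gamma0 gamma1] a0 dF Bpos aB
  [l [d [alpha [lmin dE astep x'E]]]].
case: astep => j [alphaE /(_ i) arm _].
have Bunit := posdef_unitmx Bpos; have [Bsym _] := Bpos.
have Psym : (invmx B)^T = invmx B by rewrite trmx_inv Bsym.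
have alpha0 : 0 < alpha by rewrite alphaE exprn_gt0.
have alpha1 : alpha <= 1 by rewrite alphaE exprn_ile1// ltW.
set g := weighted_gradient F l x in dE; rewrite Psym in dE.
have dB : d *m B = - g by rewrite dE mulNmx mulmxKV.
have slope : dot (gradient (component F i) x) d <= - quad B d.
  have -> : quad B d = quad (invmx B) g.
    by rewrite quadE dB dotNl dE dotNr opprK quadE dotC.
  by rewrite dE dotNr lerN2 dotC; exact: argmin_simplex_le.
have {}arm : F x' ord0 i - F x ord0 i <=
    sigma * alpha * dot (gradient (component F i) x) d.
  move: arm; rewrite -alphaE -x'E dot_gradient_component//.
  by rewrite [X in X <= _]mxE [X in _ <= X]mxE [X in _ + X <= _]mxE.
have -> : x' - x = alpha *: d by rewrite x'E addrC addKr.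
rewrite normrZ gtr0_norm//.
have := norm_sqr_le_dot d; have := loewner_le_scalar d aB => aq nd.
have sa : 0 < sigma * alpha by exact: mulr_gt0.
have h1 : sigma * alpha * (a * `|d| ^+ 2) <= sigma * alpha * quad B d.
  by rewrite ler_pM2l// (le_trans _ aq)// ler_pM2l.
have h2 : sigma * alpha * dot (gradient (component F i) x) d <=
    sigma * alpha * (- quad B d) by rewrite ler_pM2l.
(* Armijo supplies one factor [alpha]; the second one in the squared step length costs nothing since
   [alpha <= 1]. *)
have h3 : sigma * a * (alpha * `|d|) ^+ 2 <= sigma * alpha * (a * `|d| ^+ 2).
  have -> : sigma * a * (alpha * `|d|) ^+ 2 =
    alpha * (sigma * alpha * (a * `|d| ^+ 2)) by ring.
  by rewrite ler_piMl// mulr_ge0 ?(ltW sa)// mulr_ge0 ?sqr_ge0// ltW.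
lra.
Qed.

End Step.

(** * Convergence of the whole sequence *)

Theorem theorem2 (R : realType) (n m : nat) (F : 'rV[R]_n -> 'rV[R]_m)
    (sigma gamma : R) (B : nat -> 'M[R]_n) (x : nat -> 'rV[R]_n)
    (xstar : 'rV[R]_n) (lstar : 'rV[R]_m) :
  twice_continuously_differentiable F ->
  0 < sigma < 1 ->
  0 < gamma < 1 ->
  gvmm_sequence F sigma gamma B x ->
  (forall k, ~ pareto_critical F (x k)) ->
  (exists a b : R, [/\ 0 < a, 0 < b &
     forall k, loewner_le a%:M (B k) /\ loewner_le (B k) b%:M]) ->
  (forall x0 : 'rV[R]_n, compact (level_set F x0)) ->
  cluster (x @ \oo) xstar ->
  multiplier F xstar lstar ->
  (forall d : 'rV[R]_n, critical_directions F xstar d ->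
     0 < quad (weighted_hessian F lstar xstar) d) ->
  x @ \oo --> xstar.
Proof.
move=> [[dF _] dG] /andP[sigma0 _] gamma01 seqx _ [a [b [a0 _ aB]]] _ clx
  [[l1 _] wg0] sosc.
have step i k : sigma * a * `|x k.+1 - x k| ^+ 2 <=
    F (x k) ord0 i - F (x k.+1) ord0 i.
  have [Bpos st] := seqx k; have [aBk _] := aB k.
  exact: gvmm_step_descent st.
have sa0 : 0 < sigma * a by exact: mulr_gt0.
pose u i k := component F i (x k).
have Fcont i : continuous (component F i).
  by move=> y; apply/differentiable_continuous/differentiable_component.
have u_noninc i : nonincreasing_seq (u i).
  apply/nonincreasing_seqP => k; rewrite -subr_ge0 (le_trans _ (step i k))//.
  by rewrite mulr_ge0 ?sqr_ge0// ltW.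
(* Beyond index [k] the values are at most [u i k]; the bound passes to the limit along a finer
   filter converging to [xstar]. *)
have u_ge i k : component F i xstar <= u i k.
  move: clx; rewrite cluster_cvgE => -[G PG [Gx xG]].
  apply: (cvgr_to_le (cvg_trans (cvg_app _ Gx) (Fcont i xstar))).
  by apply: xG; exists k => // j; exact: u_noninc.
have u_cvg i : u i @ \oo --> component F i xstar.
  have ucv : cvgn (u i).
    apply: nonincreasing_is_cvgn => //; exists (component F i xstar) => _ [k _ <-].
    exact: u_ge.
  by rewrite (cluster_lim (f := component F i) (@Rhausdorff R) clx (Fcont i _) ucv).
(* Weights summing to 1 force [m] to be nonzero; one component suffices to control the steps. *)
have [i0 _] : exists i : 'I_m, true.
  move: l1; case: (pickP 'I_m) => [i _ _|no]; first by exists i.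
  by rewrite big1 => [/eqP|i]; [rewrite eq_sym oner_eq0|have := no i].
apply: cvg_isolated_cluster => //.
  have sq0 : (fun k => `|x k.+1 - x k| ^+ 2) @ \oo --> (0 : R).
    have : (fun k => (sigma * a)^-1 * (u i0 k - u i0 k.+1)) @ \oo --> (0 : R).
      rewrite -[X in _ --> X](mulr0 (sigma * a)^-1) -(subrr (component F i0 xstar)).
      apply: cvgM; first exact: cvg_cst.
      apply: cvgB; first exact: u_cvg.
      by rewrite (cvg_shiftS (u i0)); exact: u_cvg.
    apply: squeeze_cvgr; last exact: cvg_cst.
    by apply: nearW => k; rewrite sqr_ge0/= ler_pdivlMl//; exact: step.
  apply/cvgr0Pnorm_lt => e e0.
  move/cvgr0Pnorm_lt : sq0 => /(_ _ (exprn_gt0 2 e0)).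
  by apply: filterS => k; rewrite normrX !normr_id ltr_pXn2r ?nnegrE ?(ltW e0)//.
(* Each [u i] converges to [component F i xstar], so every cluster point lies in the level of
   [xstar], where [xstar] is isolated. *)
have := isolated_level dF (fun i => (dG i).1 xstar) wg0 sosc.
apply: filterS => y iso cly; apply: iso; apply/rowP => i.
exact: (cluster_lim (@Rhausdorff R) cly (Fcont i y) (u_cvg i)).
Qed.
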